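(* Let $F$ be a probability distribution on $[0,\infty)$ with mean $\mu$. For $n\ge 2$ consider the relation $$(\ast_n)\qquad \overline{F^{n*}}(x)-n\overline{F}(x)\ \sim\ n(n-1)\mu\,F(x,x+1],\qquad x\to\infty .$$ (1) Assume $F\in\mathscr{S}_2$. Then $(\ast_n)$ holds for all $n\ge 2$. (2) Assume $F\in\mathscr{L}_{\Delta(t)}$ for all $t\in(0,\infty)$, $\mu<\infty$ and $\overline{F}^2(x)=o(F(x,x+1])$ as $x\to\infty$. If for some $n\ge 2$ the relation $(\ast_n)$ holds, then $F\in\mathscr{S}_2$.
   Context: For a distribution $F$ on $[0,\infty)$: $\overline{F}(x)=1-F(x)$, $\overline{F}^2(x)=(\overline{F}(x))^2$, $F(a,b]=F(b)-F(a)$, and $F^{n*}=F^{*n}$ is the $n$-fold convolution of $F$. For $t\in(0,\infty)$ put $\Delta(t)=(0,t]$ and $F(x+\Delta(t))=F(x,x+t]$. $a(x)\sim b(x)$ means $\lim_{x\to\infty}a(x)/b(x)=1$; $a(x)=o(b(x))$ means $\lim_{x\to\infty}a(x)/b(x)=0$. $F\in\mathscr{L}_{\Delta(t)}$ (local long-tailed) if $F(x+y+\Delta(t))\sim F(x+\Delta(t))$ as $x\to\infty$, uniformly in $y\in[0,1]$. $F\in\mathscr{S}_{\Delta(t)}$ (local subexponential) if $F\in\mathscr{L}_{\Delta(t)}$ and $F^{*2}(x+\Delta(t))\sim 2F(x+\Delta(t))$ as $x\to\infty$. $F\in\mathscr{S}_2$ (second order subexponential) if $F$ is a distribution on $[0,\infty)$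 with finite mean $\mu$, $F\in\mathscr{S}_{\Delta(t)}$ for all $t\in(0,\infty)$, and $\overline{F^{2*}}(x)-2\overline{F}(x)\sim 2\mu F(x,x+1]$ as $x\to\infty$. *)

(* Defs.v *)
From HB Require Import structures.
From mathcomp Require Import all_boot all_order all_algebra.
From mathcomp Require Import all_classical all_reals all_analysis.

Set Implicit Arguments.
Unset Strict Implicit.
Unset Printing Implicit Defensive.

Import Order.TTheory GRing.Theory Num.Theory.
Import numFieldNormedType.Exports.

Local Open Scope classical_set_scope.
Local Open Scope ring_scope.

Notation law R := (probability (measurableTypeR R) R).

Section asymptotics.
Context {R : realType}.
Implicit Types a b : R -> R.

(* Division is total, with [x / 0 = 0].  Hence [asym_eq a b] still forces
   [b x != 0] for all large [x], whereas [asym_o a b] does not: it has its usual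
   meaning only for [b] that is eventually nonzero, which local long-tailedness
   of F guarantees for [b x = F(x, x + t]]. *)
Definition asym_eq a b := (a x / b x) @[x --> +oo] --> (1 : R).

Definition asym_o a b := (a x / b x) @[x --> +oo] --> (0 : R).

End asymptotics.

Section laws.
Context {R : realType}.
Implicit Types F G : law R.

Definition on_nonneg F := F `[0, +oo[%classic = 1%E.

(* Finite since [F] is a probability, so [fine] loses nothing. *)
Definition df F (x : R) : R := fine (F `]-oo, x]%classic).

Definition tail F (x : R) : R := 1 - df F x.

Definition incr F (a b : R) : R := df F b - df F a.

(* Extended-real valued: no integrability is presupposed.  For [F] on the
   nonnegative half-line it is well defined, and [mean F < +oo] says that the
   mean is finite. *)
Definition mean F : \bar R := 'E_F[(id : R -> R)].

Definition plus (z : measurableTypeR R * measurableTypeR R) : measurableTypeR R :=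
  (z.1 : R) + (z.2 : R).

Lemma measurable_plus : measurable_fun setT plus.
Proof.
by apply: measurable_realfun.measurable_funD;
  [exact: measurable_fst|exact: measurable_snd].
Qed.

HB.instance Definition _ := isMeasurableFun.Build _ _ _ _ plus measurable_plus.

(* The law of the sum of two independent variables with laws F and G. *)
Definition convol F G : law R := distribution (F \x G)%E plus.

Definition nconvol F n : law R := iter n (convol F) (\d_(0 : measurableTypeR R)).

Definition local_long_tailed (t : R) F :=
  {uniform `[(0 : R), 1]%classic,
    (fun x y : R => incr F (x + y) (x + y + t) / incr F x (x + t) : R) @ +oo -->
    (cst 1 : R -> R)}.

Definition local_subexponential (t : R) F :=
  local_long_tailed t F /\
  asym_eq (fun x => incr (nconvol F 2) x (x + t))
          (fun x => 2 * incr F x (x + t)).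

Definition second_order_subexponential F :=
  [/\ on_nonneg F,
      (mean F < +oo)%E,
      (forall t, 0 < t -> local_subexponential t F) &
      asym_eq (fun x => tail (nconvol F 2) x - 2 * tail F x)
              (fun x => 2 * fine (mean F) * incr F x (x + 1))].

End laws.

(* Main.v *)
Require Import Defs.
From mathcomp Require Import all_boot all_order all_algebra.
From mathcomp Require Import all_classical all_reals all_analysis.
From mathcomp Require Import measurable_realfun ring lra.

Import Order.TTheory GRing.Theory Num.Theory.
Import numFieldNormedType.Exports.

(** Let X, X', S_n be independent, X and X' with law F, S_n a sum of n variables
    with law F, mu the mean of F, f(x) = F(x, x + 1] and
    H_n(x) = P(S_n > x) - n P(X > x), the excess of order n.  The assertion
    about n says that H_n is equivalent to n (n - 1) mu f.

    Conditioning on one summand gives a recursion [excess_rec],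
      H_{n+1}(x) = I_n(x) + n H_2(x)   with   I_n(x) = E[H_n(x - X); X <= x],
    and everything rests on the fact that a bound H_n ~ c f is inherited by I_n
    with the same c: then the constants satisfy c_{n+1} = c_n + 2 n mu, which
    is solved by n (n - 1) mu.

    To see why, cut at X = x - A with A large [excess_smoothed_split].
    - On X <= x - A the integrand is about c f(x - X).  The values of X close to
      0 contribute c f(x), because F is long-tailed [small_part_ge].  The others
      contribute a nonnegative amount, which suffices for the lower bound
      [excess_smoothed_ge].  Under local subexponentiality that amount is
      negligible: P(X + X' in (x, x + 1]) is about 2 f(x), and the cases of X
      small and of X' small already account for it [excess_smoothed_le].
    - On x - A < X <= x, Fubini turns E[P(S_n > x - X)] into the expected F-mass
      of an interval of random length min(S_n, A) ending at x [overshoot].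
      Around x the law F looks like f(x) times Lebesgue measure, uniformly on
      bounded windows [incr_uniform], so this is about f(x) E[min(S_n, A)].
      The contribution of H_n is therefore f(x) times
      E[min(S_n, A)] - n E[min(X, A)], which vanishes as A grows
      [mclip_nconvol_diff].

    The first part of the theorem follows by induction from the case n = 2.  For
    the second part, the hypothesis on the squared tail yields a lower bound
    2 mu f for H_2 [excess2_ge]: a sum of two exceeds x if one term exceeds x
    minus the other, and the overlap of these two events has probability
    o(f(x)).  The recursion propagates the lower bound to all H_n [excess_ge];
    read backwards, it then turns the upper bound on a single H_n into one on
    H_2 [excess2_le].  Finally H_2 ~ 2 mu f makes
      P(X + X' in (x, x + t]) - 2 F(x, x + t] = H_2(x) - H_2(x + t)
    of order o(f(x)), which is local subexponentiality
    [local_subexponential_of_excess2]. *)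

Set Implicit Arguments.
Unset Strict Implicit.

Local Open Scope classical_set_scope.
Local Open Scope ring_scope.

(** * Expectations of bounded measurable functions *)

(** Bounded measurable functions: stable under all the operations below and
    integrable for every probability, so that the integrals can be real-valued
    and manipulated without integrability conditions. *)
Definition bdm {R : realType} {d : measure_display} {T : measurableType d}
  (g : T -> R) :=
  measurable_fun setT g /\ exists M : R, forall x, `|g x| <= M.

Section bdm.
Context {R : realType} {d} {T : measurableType d}.
Implicit Types (g h : T -> R) (b : T -> bool).

Lemma bdm_integrable (P : probability T R) g :
  bdm g -> P.-integrable setT (EFin \o g).
Proof.
move=> [mg [M gM]]; apply: measurable_bounded_integrable.
- exact: measurableT.
- by rewrite (le_lt_trans (probability_le1 _ _)) ?ltry.
- exact: mg.
- by exists M; split; [exact: num_real|move=> N MN x _; exact: le_trans (ltW MN)].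
Qed.

Lemma bdm_cst (c : R) : bdm (fun _ : T => c).
Proof. by split; [exact: measurable_cst|exists `|c|]. Qed.

Lemma bdmD g h : bdm g -> bdm h -> bdm (fun x => g x + h x).
Proof.
move=> [mg [M gM]] [mh [N hN]]; split; first exact: measurable_funD.
by exists (M + N) => x; rewrite (le_trans (ler_normD _ _))// lerD.
Qed.

Lemma bdmM g h : bdm g -> bdm h -> bdm (fun x => g x * h x).
Proof.
move=> [mg [M gM]] [mh [N hN]]; split; first exact: measurable_funM.
by exists (M * N) => x; rewrite normrM ler_pM.
Qed.

Lemma bdmB g h : bdm g -> bdm h -> bdm (fun x => g x - h x).
Proof.
move=> bg bh; have -> : (fun x => g x - h x) = (fun x => g x + -1 * h x).
  by apply/funext => x; rewrite mulN1r.
by apply: bdmD => //; apply: bdmM => //; exact: bdm_cst.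
Qed.

Lemma bdm_bool b : measurable_fun setT b -> bdm (fun x => (b x)%:R : R).
Proof.
move=> mb; split; last by exists 1 => x; case: (b x); rewrite ?normr1 ?normr0.
by apply: (measurableT_comp (f := fun c : bool => c%:R : R)).
Qed.

Lemma bdm_comp {d'} {S : measurableType d'} (k : S -> T) g :
  measurable_fun setT k -> bdm g -> bdm (fun x => g (k x)).
Proof.
move=> mk [mg [M gM]]; split; first exact: measurableT_comp.
by exists M => x.
Qed.

End bdm.

Definition Ex {R : realType} {d : measure_display} {T : measurableType d}
  (P : probability T R) (g : T -> R) : R := \int[P]_x g x.

Section Ex.
Context {R : realType} {d : measure_display} {T : measurableType d}.
Variable P : probability T R.
Implicit Types (g h : T -> R) (b : T -> bool) (c : R).

Lemma EFin_Ex g : bdm g -> (Ex P g)%:E = (\int[P]_x (g x)%:E)%E.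
Proof.
move=> bg; rewrite /Ex /Rintegral fineK//.
by apply: integrable_fin_num => //; exact: bdm_integrable.
Qed.

Lemma ExD g h : bdm g -> bdm h -> Ex P (fun x => g x + h x) = Ex P g + Ex P h.
Proof. by move=> bg bh; rewrite /Ex RintegralD//; exact: bdm_integrable. Qed.

Lemma ExB g h : bdm g -> bdm h -> Ex P (fun x => g x - h x) = Ex P g - Ex P h.
Proof. by move=> bg bh; rewrite /Ex RintegralB//; exact: bdm_integrable. Qed.

Lemma ExZ c g : bdm g -> Ex P (fun x => c * g x) = c * Ex P g.
Proof. by move=> bg; rewrite /Ex RintegralZl//; exact: bdm_integrable. Qed.

Lemma Ex_cst c : Ex P (fun _ => c) = c.
Proof.
by rewrite /Ex /Rintegral integral_cst//= probability_setT mule1.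
Qed.

Lemma Ex_bool b : measurable_fun setT b ->
  Ex P (fun x => (b x)%:R) = fine (P [set x | b x]).
Proof.
move=> mb; have mB : measurable [set x | b x].
  have -> : [set x | b x] = setT `&` b @^-1` [set true].
    by apply/seteqP; split => x /=; [move=> ->|case].
  exact: mb.
rewrite /Ex /Rintegral; congr fine.
rewrite -(setIT [set x | b x]) -integral_indic//.
apply: eq_integral => x _; rewrite indicE; congr (_%:R%:E).
by have [bx|/negP bx] := boolP (b x); [rewrite mem_set|rewrite memNset].
Qed.

Lemma probability_setC0 (D : set T) :
  measurable D -> P D = 1%E -> P (~` D) = 0%E.
Proof. by move=> mD PD; rewrite probability_setC// PD subee. Qed.

Lemma Ex_le_on (D : set T) g h : measurable D -> P D = 1%E -> bdm g -> bdm h ->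
  (forall x, D x -> g x <= h x) -> Ex P g <= Ex P h.
Proof.
move=> mD PD bg bh gh.
have P0 := probability_setC0 mD PD.
have key k : bdm k -> Ex P k = \int[P]_(x in D) k x.
  move=> bk; rewrite /Ex /Rintegral (negligible_integral _ _ _ P0)//.
  - by rewrite setTD setCK.
  - exact: measurableC.
  - exact: bdm_integrable.
rewrite !key//; apply: le_Rintegral => //.
- by apply: integrableS (bdm_integrable P bg).
- by apply: integrableS (bdm_integrable P bh).
Qed.

Lemma Ex_le g h : bdm g -> bdm h -> (forall x, g x <= h x) -> Ex P g <= Ex P h.
Proof. by move=> bg bh gh; apply: le_Rintegral => //; exact: bdm_integrable. Qed.

Lemma Ex_eq g h : g =1 h -> Ex P g = Ex P h.
Proof. by move=> /funext ->. Qed.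

End Ex.

Section Ex_pair.
Context {R : realType} {d d' : measure_display}
  {T : measurableType d} {T' : measurableType d'}.
Variables (P : probability T R) (Q : probability T' R) (k : T * T' -> R).
Hypothesis bk : bdm k.

Lemma bdm_pair1 x : bdm (fun y => k (x, y)).
Proof. apply: (bdm_comp (k := fun y => (x, y))) bk; exact: pair1_measurable. Qed.

Lemma bdm_pair2 y : bdm (fun x => k (x, y)).
Proof. apply: (bdm_comp (k := fun x => (x, y))) bk; exact: pair2_measurable. Qed.

Let ik : (P \x Q)%E.-integrable setT (EFin \o k).
Proof. exact: (@bdm_integrable R _ _ (P \x Q)%E). Qed.

Lemma bdm_Ex : bdm (fun x => Ex Q (fun y => k (x, y))).
Proof.
split.
  apply/measurable_EFinP.
  have -> : EFin \o (fun x => Ex Q (fun y => k (x, y))) =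
      fun x => (\int[Q]_y (EFin \o k) (x, y))%E.
    by apply/funext => x /=; rewrite EFin_Ex//; exact: bdm_pair1.
  exact: (measurable_fubini_F ik).
have [_ [M kM]] := bk; exists M => x; rewrite ler_norml -{1}(Ex_cst Q (- M)).
rewrite -{2}(Ex_cst Q M); apply/andP; split; apply: Ex_le;
  do ?[exact: bdm_cst|exact: bdm_pair1] => y;
  by have := kM (x, y); rewrite ler_norml => /andP[].
Qed.

Lemma Ex_prod :
  Ex (P \x Q)%E k = Ex P (fun x => Ex Q (fun y => k (x, y))).
Proof.
apply: EFin_inj; rewrite EFin_Ex// [RHS]EFin_Ex; last exact: bdm_Ex.
rewrite -(integral12_prod_meas1 ik); apply: eq_integral => x _.
by rewrite EFin_Ex//; exact: bdm_pair1.
Qed.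

End Ex_pair.

Lemma Ex_swap {R : realType} {d d' : measure_display} {T : measurableType d}
    {T' : measurableType d'} (P : probability T R) (Q : probability T' R)
    (k : T * T' -> R) : bdm k ->
  Ex P (fun x => Ex Q (fun y => k (x, y))) =
  Ex Q (fun y => Ex P (fun x => k (x, y))).
Proof.
move=> bk; have bk' : bdm (fun z : T' * T => k (z.2, z.1)).
  by apply: (bdm_comp (k := fun z : T' * T => (z.2, z.1))) bk;
    exact: measurable_swap.
apply: EFin_inj; rewrite EFin_Ex; last exact: (bdm_Ex P Q).
rewrite [RHS]EFin_Ex; last exact: (bdm_Ex Q P bk').
under eq_integral => x _ do rewrite (EFin_Ex _ (bdm_pair1 bk x)).
under [RHS]eq_integral => x _ do rewrite (EFin_Ex _ (bdm_pair2 bk x)).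
exact: (Fubini (@bdm_integrable R _ _ (P \x Q)%E k bk)).
Qed.


Lemma Ex_convol {R : realType} (F G : law R) (g : measurableTypeR R -> R) :
  bdm g -> Ex (convol F G) g = Ex F (fun y => Ex G (fun s => g (y + s))).
Proof.
move=> bg.
rewrite -(Ex_prod F G (k := fun z => g (plus z))); last first.
  by apply: bdm_comp bg; exact: measurable_plus.
rewrite /Ex /Rintegral; congr fine.
rewrite integral_distribution//; first by case: bg => mg _; exact/measurable_EFinP.
apply: (@bdm_integrable R _ _ (F \x G)%E (g \o plus)).
by apply: bdm_comp bg; exact: measurable_plus.
Qed.
(** * Tails, increments and convolutions of laws *)

Notation "[ 'ind' b ]" := (1%R *+ nat_of_bool b%R)%R
  (at level 0, b at level 99, format "[ 'ind'  b ]").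

Ltac meas := repeat first
  [ exact: measurable_cst | exact: measurable_id | exact: measurable_fst
  | exact: measurable_snd | apply: measurable_and
  | apply: measurable_fun_ltr | apply: measurable_fun_ler
  | apply: measurable_funB | apply: measurable_funD
  | apply: measurable_minr | apply: measurable_maxr ].

Ltac bounded := repeat first
  [ assumption | exact: bdm_cst | apply: bdmD | apply: bdmB | apply: bdmM
  | (apply: bdm_bool; meas; fail) ].

Lemma ind_le {R : realType} (a b : bool) : (a -> b) -> [ind a] <= [ind b] :> R.
Proof. by case: a; case: b => // /(_ isT). Qed.

(** min(s, A) for s >= 0; the cut at 0 makes it bounded on the whole line. *)
Definition clip {R : realType} (A s : R) : R := Num.min (Num.max s 0) A.

Section laws.
Context {R : realType}.
Implicit Types (F G : law R) (x y s u A : R).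
Local Notation mR := (measurableTypeR R).

Lemma bdm_clip (d : measure_display) (T : measurableType d) (g : T -> R) A :
  0 <= A -> measurable_fun setT g -> bdm (fun z => clip A (g z)).
Proof.
move=> A0 mg; split; first by rewrite /clip; meas.
exists A => z; rewrite /clip ger0_norm ?ge_min ?lexx ?orbT//.
by rewrite le_min le_max lexx orbT.
Qed.

Lemma dfE F x : df F x = Ex F (fun y : mR => [ind (y : R) <= x]).
Proof.
rewrite Ex_bool; last by meas.
by rewrite /df; congr (fine (F _)); apply/seteqP; split => y /=; rewrite in_itv.
Qed.

Lemma tailE F x : tail F x = Ex F (fun y : mR => [ind x < (y : R)]).
Proof.
rewrite /tail dfE -{1}(Ex_cst F 1) -ExB; [|by bounded|by bounded].
by apply: Ex_eq => y; rewrite ltNge; case: leP; rewrite ?subrr ?subr0.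
Qed.

Lemma incr_tail F x y : incr F x y = tail F x - tail F y.
Proof. by rewrite /incr /tail; ring. Qed.

Lemma bdm_tail F : bdm (tail F : mR -> R).
Proof.
have -> : tail F = fun x : mR => Ex F (fun y : mR => [ind (x : R) < (y : R)]).
  by apply/funext => x; exact: tailE.
apply: (@bdm_Ex R _ _ mR mR F F (fun z => [ind (z.1 : R) < (z.2 : R)])).
by bounded.
Qed.

Lemma le_tail F x y : x <= y -> tail F y <= tail F x.
Proof.
move=> xy; rewrite !tailE; apply: Ex_le; [by bounded|by bounded|move=> s].
by apply: ind_le; exact: le_lt_trans.
Qed.



Lemma tail_ge0 F x : 0 <= tail F x.
Proof.
rewrite tailE -(Ex_cst F 0); apply: Ex_le; [by bounded|by bounded|move=> s].
exact: ler0n.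
Qed.

Lemma tail_le1 F x : tail F x <= 1.
Proof.
rewrite tailE -[leRHS](Ex_cst F 1); apply: Ex_le; [by bounded|by bounded|].
by move=> s; rewrite lern1; case: (_ < _).
Qed.

Lemma incr_ge0 F x y : x <= y -> 0 <= incr F x y.
Proof. by move=> xy; rewrite incr_tail subr_ge0 le_tail. Qed.

Lemma incrE F x y : x <= y ->
  incr F x y = Ex F (fun z : mR => [ind (x < (z : R)) && ((z : R) <= y)]).
Proof.
move=> xy; rewrite incr_tail !tailE -ExB; [|by bounded|by bounded].
apply: Ex_eq => z; rewrite [(z : R) <= y]leNgt.
case: (ltP y (z : R)) => [yz|_]; first by rewrite (le_lt_trans xy yz) subrr.
by rewrite subr0 andbT.
Qed.

Lemma bdm_tail_shift F x : bdm (fun y : mR => tail F (x - y)).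
Proof.
apply: (bdm_comp (k := fun y : mR => (x - (y : R) : mR))) (bdm_tail F).
by meas.
Qed.

Lemma bdm_incr_shift F x t : bdm (fun y : mR => incr F (x - y) (x - y + t)).
Proof.
have -> : (fun y : mR => incr F (x - y) (x - y + t)) =
    fun y : mR => tail F (x - y) - tail F (x + t - y).
  by apply/funext => y; rewrite incr_tail; congr (_ - tail F _); exact: addrAC.
by apply: bdmB; exact: bdm_tail_shift.
Qed.

Lemma on_nonnegP F :
  on_nonneg F <-> Ex F (fun y : mR => [ind 0 <= (y : R)]) = 1.
Proof.
rewrite Ex_bool; last by meas.
rewrite (_ : [set x : mR | _] = `[0, +oo[%classic); last first.
  by apply/seteqP; split => y /=; rewrite in_itv/= andbT.
rewrite /on_nonneg; split => [->//|F1].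
by rewrite -[LHS]fineK ?F1// fin_num_measure.
Qed.

Lemma Ex_le_nonneg F (g h : mR -> R) : on_nonneg F -> bdm g -> bdm h ->
  (forall y : R, 0 <= y -> g y <= h y) -> Ex F g <= Ex F h.
Proof.
move=> F0 bg bh gh; apply: (@Ex_le_on R _ mR F `[0, +oo[%classic) => //.
by move=> y /=; rewrite in_itv/= andbT; exact: gh.
Qed.

Lemma tail_lt0 F x : on_nonneg F -> x < 0 -> tail F x = 1.
Proof.
move=> F0 x0; apply/eqP; rewrite eq_le tail_le1/= tailE -[leLHS](Ex_cst F 1).
apply: Ex_le_nonneg => //; [by bounded|by bounded|move=> y y0].
by rewrite (lt_le_trans x0 y0).
Qed.

Lemma on_nonneg_convol F G : on_nonneg F -> on_nonneg G -> on_nonneg (convol F G).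
Proof.
move=> F0 G0; apply/on_nonnegP; rewrite Ex_convol; last by bounded.
have bi : bdm (fun z : mR * mR => [ind 0 <= (z.1 : R) + z.2] : R) by bounded.
apply/eqP; rewrite eq_le; apply/andP; split.
  rewrite -[leRHS](Ex_cst F 1); apply: Ex_le; [exact: (bdm_Ex F G bi)|by bounded|].
  move=> y; rewrite -[leRHS](Ex_cst G 1); apply: Ex_le; [by bounded|by bounded|].
  by move=> s; rewrite lern1; case: (_ <= _).
rewrite -[leLHS](Ex_cst F 1); apply: Ex_le_nonneg => //.
- by bounded.
- exact: (bdm_Ex F G bi).
move=> y y0; rewrite -[leLHS](Ex_cst G 1); apply: Ex_le_nonneg => //.
- by bounded.
- by bounded.
by move=> s s0; rewrite addr_ge0.
Qed.

Lemma tail_convol F G x :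
  tail (convol F G) x = Ex F (fun y : mR => tail G (x - y)).
Proof.
rewrite tailE Ex_convol; last by bounded.
by apply: Ex_eq => y; rewrite tailE; apply: Ex_eq => s; rewrite ltrBlDl.
Qed.

End laws.
Section two_laws.
Context {R : realType}.
Implicit Types (F G : law R) (x y s u A : R).
Local Notation mR := (measurableTypeR R).

Variant clip_spec A s : R -> Prop :=
  | ClipNeg of s <= 0 : clip_spec A s 0
  | ClipMid of 0 < s & s <= A : clip_spec A s s
  | ClipBig of 0 < s & A < s : clip_spec A s A.

Lemma clipP A s : 0 <= A -> clip_spec A s (clip A s).
Proof.
move=> A0; rewrite /clip; case: (leP s 0) => s0.
  by rewrite (min_idPl A0); constructor.
by case: (leP s A) => sA; constructor.
Qed.

Lemma clip_ge0 A s : 0 <= A -> 0 <= clip A s.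
Proof. by move=> A0; case: clipP => // /ltW. Qed.

Lemma clip_le A s : clip A s <= A.
Proof. by rewrite ge_min lexx orbT. Qed.

(** For S with law G, both sides are the probability that x - A < X <= x and
    X + S > x: the right-hand side integrates over X first. *)
Lemma overshoot F G A x : 0 <= A ->
  Ex F (fun y : mR => [ind (x - A < (y : R)) && ((y : R) <= x)] * tail G (x - y)) =
  Ex G (fun s : mR => incr F (x - clip A s) x).
Proof.
move=> A0.
pose k (z : mR * mR) : R := [ind (x - A < (z.1 : R)) && ((z.1 : R) <= x)] *
  [ind x - (z.1 : R) < z.2].
have bk : bdm k by rewrite /k; bounded.
transitivity (Ex F (fun y => Ex G (fun s => k (y, s)))).
  by apply: Ex_eq => y; rewrite tailE -ExZ//; bounded.
rewrite Ex_swap//; apply: Ex_eq => s.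
rewrite incrE ?gerBl ?clip_ge0//; apply: Ex_eq => y; rewrite /k/=.
rewrite -natrM mulnb; congr (_%:R); congr nat_of_bool.
case: clipP => // [s0|s0 sA|s0 As]; lra.
Qed.



Lemma bdm_ind_incr F a x t :
  bdm (fun y : mR => [ind (y : R) <= a] * incr F (x - y) (x - y + t)).
Proof. by apply: bdmM; [bounded|exact: bdm_incr_shift]. Qed.

(** If the sum of Y (law F) and S (law G) lies in (x, x + t] then S <= A forces
    Y > x - A, so the cases Y <= x - A and S <= A are disjoint. *)
Lemma convol_incr_ge F G A x t : 0 <= t ->
  Ex F (fun y : mR => [ind (y : R) <= x - A] * incr G (x - y) (x - y + t)) +
  Ex G (fun s : mR => [ind (s : R) <= A] * incr F (x - s) (x - s + t)) <=
  incr (convol F G) x (x + t).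
Proof.
move=> t0.
pose k (z : mR * mR) : R := [ind (z.2 : R) <= A] *
  [ind (x - (z.1 : R) < z.2) && ((z.2 : R) <= x - (z.1 : R) + t)].
have bk : bdm k by rewrite /k; bounded.
have -> : Ex G (fun s : mR => [ind (s : R) <= A] * incr F (x - s) (x - s + t)) =
    Ex F (fun y => Ex G (fun s => k (y, s))).
  rewrite Ex_swap//; apply: Ex_eq => s.
  rewrite incrE ?lerDl// -ExZ; last by bounded.
  apply: Ex_eq => y; rewrite /k/=; congr (_ * _%:R); congr nat_of_bool.
  by move: y s => /= y s; lra.
have -> : incr (convol F G) x (x + t) =
    Ex F (fun y : mR => incr G (x - y) (x - y + t)).
  rewrite incr_tail !tail_convol -ExB; [|exact: bdm_tail_shift..].
  by apply: Ex_eq => y; rewrite incr_tail; congr (_ - tail G _); exact: addrAC.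
rewrite -ExD; [|exact: bdm_ind_incr|exact: (bdm_Ex F G bk)].
apply: Ex_le => [||y].
- by apply: bdmD; [exact: bdm_ind_incr|exact: (bdm_Ex F G bk)].
- exact: bdm_incr_shift.
case: (leP (y : R) (x - A)) => yxA; last first.
  rewrite mul0r add0r incrE ?lerDl//; apply: Ex_le; [|by bounded|].
    exact: bdm_pair1.
  by move=> s; rewrite /k/= -natrM mulnb; apply: ind_le => /andP[].
rewrite mul1r gerDl -(Ex_cst G 0); apply: Ex_le; [|by bounded|].
  exact: bdm_pair1.
move=> s; rewrite /k/= -natrM mulnb.
suff -> : ((s : R) <= A) && (x - (y : R) < s <= x - (y : R) + t) = false by [].
move: y s yxA => /= y s; lra.
Qed.

(** A sum exceeds x when one term exceeds x minus the clipped other term.  If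
    both terms do so, both exceed x - A, so subtracting that event once undoes
    the double count. *)
Lemma ind_exceed_ge A x y s : 0 <= A -> 0 <= y -> 0 <= s ->
  [ind x - clip A s < y] + [ind x - clip A y < s] -
    [ind x - A < y] * [ind x - A < s] <= [ind x - y < s] :> R.
Proof.
move=> A0 y0 s0.
have ys : clip A s <= s by case: (clipP s A0) => // _ /ltW.
have yy : clip A y <= y by case: (clipP y A0) => // _ /ltW.
have sA := clip_le A s; have yA := clip_le A y.
by do 5 case: ltP => ? //=; lra.
Qed.

(** The integrated form of [ind_exceed_ge]. *)
Lemma convol_tail_ge F G A x : on_nonneg F -> on_nonneg G -> 0 <= A ->
  Ex G (fun s : mR => tail F (x - clip A s)) +
  Ex F (fun y : mR => tail G (x - clip A y)) - tail F (x - A) * tail G (x - A) <=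
  tail (convol F G) x.
Proof.
move=> F0 G0 A0.
pose k1 (z : mR * mR) : R := [ind x - clip A z.2 < (z.1 : R)].
pose k2 (z : mR * mR) : R := [ind x - clip A z.1 < (z.2 : R)].
pose k3 (z : mR * mR) : R := [ind x - A < (z.1 : R)] * [ind x - A < (z.2 : R)].
pose k4 (z : mR * mR) : R := [ind x - (z.1 : R) < (z.2 : R)].
have b1 : bdm k1 by rewrite /k1/clip; bounded.
have b2 : bdm k2 by rewrite /k2/clip; bounded.
have b3 : bdm k3 by rewrite /k3; bounded.
have b4 : bdm k4 by rewrite /k4; bounded.
have -> : Ex G (fun s : mR => tail F (x - clip A s)) =
    Ex F (fun y => Ex G (fun s => k1 (y, s))).
  by rewrite Ex_swap//; apply: Ex_eq => s; rewrite tailE.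
have -> : Ex F (fun y : mR => tail G (x - clip A y)) =
    Ex F (fun y => Ex G (fun s => k2 (y, s))).
  by apply: Ex_eq => y; rewrite tailE.
have -> : tail F (x - A) * tail G (x - A) =
    Ex F (fun y => Ex G (fun s => k3 (y, s))).
  rewrite [tail F _]tailE mulrC -ExZ; last by bounded.
  by apply: Ex_eq => y; rewrite tailE mulrC -ExZ//; bounded.
have -> : tail (convol F G) x = Ex F (fun y => Ex G (fun s => k4 (y, s))).
  by rewrite tail_convol; apply: Ex_eq => y; rewrite tailE.
have e1 := bdm_Ex F G b1; have e2 := bdm_Ex F G b2.
have e3 := bdm_Ex F G b3; have e4 := bdm_Ex F G b4.
rewrite -ExD// -ExB//; last exact: bdmD.
apply: Ex_le_nonneg => //; first by apply: bdmB => //; exact: bdmD.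
move=> y y0.
have p1 := bdm_pair1 b1 y; have p2 := bdm_pair1 b2 y; have p3 := bdm_pair1 b3 y.
rewrite -ExD// -ExB//; last exact: bdmD.
apply: Ex_le_nonneg => //; first by apply: bdmB => //; exact: bdmD.
  exact: (bdm_pair1 b4).
by move=> s s0; exact: ind_exceed_ge.
Qed.

End two_laws.
(** * Clipped means *)

Section clipped_mean.
Context {R : realType}.
Implicit Types (F G : law R) (x y s u A e : R).
Local Notation mR := (measurableTypeR R).

(** Clipped means stand in for the means of convolution powers: they are always
    finite, and they are comparable under convolution [mclip_convol]. *)
Definition mclip F A : R := Ex F (fun y : mR => clip A y).

Lemma bdm_clip1 A : 0 <= A -> bdm (fun y : mR => clip A y).
Proof. by move=> A0; apply: bdm_clip => //; meas. Qed.

Lemma le_mclip F A B : 0 <= A -> A <= B -> mclip F A <= mclip F B.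
Proof.
move=> A0 AB; have B0 := le_trans A0 AB.
apply: Ex_le; [exact: bdm_clip1|exact: bdm_clip1|move=> y].
by case: (clipP y A0) => ?; case: (clipP y B0) => ?; lra.
Qed.

(** min(y, A / 2) + min(s, A / 2) <= min(y + s, A) <= min(y, A) + min(s, A) for
    nonnegative y and s. *)
Lemma mclip_convol F G A : 0 <= A -> on_nonneg F -> on_nonneg G ->
  mclip F (A / 2) + mclip G (A / 2) <= mclip (convol F G) A <=
    mclip F A + mclip G A.
Proof.
move=> A0 F0 G0; have A20 : 0 <= A / 2 by lra.
pose k (z : mR * mR) : R := clip A ((z.1 : R) + z.2).
have bk : bdm k by apply: bdm_clip => //; meas.
rewrite /mclip Ex_convol; last exact: bdm_clip1.
have sumE B : 0 <= B ->
    Ex F (fun y : mR => clip B y) + Ex G (fun y : mR => clip B y) =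
    Ex F (fun y : mR => Ex G (fun s : mR => clip B y + clip B s)).
  move=> B0; rewrite -{1}(Ex_cst F (Ex G (fun y : mR => clip B y))).
  rewrite -ExD; [|exact: bdm_clip1|exact: bdm_cst].
  apply: Ex_eq => y; rewrite -{1}(Ex_cst G (clip B y)) -ExD//; first exact: bdm_cst.
  exact: bdm_clip1.
have bs B : 0 <= B -> bdm (fun z : mR * mR => clip B z.1 + clip B z.2).
  by move=> B0; apply: bdmD; apply: bdm_clip => //; meas.
rewrite !sumE//; apply/andP; split.
  apply: Ex_le_nonneg => //; [exact: (bdm_Ex F G (bs _ A20))|exact: (bdm_Ex F G bk)|].
  move=> y y0; apply: Ex_le_nonneg => //;
    [exact: (bdm_pair1 (bs _ A20))|exact: (bdm_pair1 bk)|].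
  move=> s s0.
  by case: (clipP y A20) => ?; case: (clipP s A20) => ?;
    case: (clipP (y + s) A0) => ?; lra.
apply: Ex_le_nonneg => //; [exact: (bdm_Ex F G bk)|exact: (bdm_Ex F G (bs _ A0))|].
move=> y y0; apply: Ex_le_nonneg => //;
  [exact: (bdm_pair1 bk)|exact: (bdm_pair1 (bs _ A0))|].
move=> s s0.
by case: (clipP y A0) => ?; case: (clipP s A0) => ?;
  case: (clipP (y + s) A0) => ?; lra.
Qed.

Lemma Ex_dirac (g : mR -> R) : bdm g -> Ex (\d_(0 : mR)) g = g 0.
Proof.
move=> [mg _]; rewrite /Ex /Rintegral integral_dirac//; last exact/measurable_EFinP.
by rewrite diracT mul1e.
Qed.

Lemma on_nonneg_dirac : on_nonneg (\d_(0 : mR) : law R).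
Proof. by rewrite /on_nonneg /= diracE mem_set//= in_itv/= lexx. Qed.

Lemma on_nonneg_nconvol F n : on_nonneg F -> on_nonneg (nconvol F n).
Proof.
move=> F0; elim: n => [|n IHn]; first exact: on_nonneg_dirac.
exact: on_nonneg_convol.
Qed.

Lemma tail_nconvol1 F : tail (nconvol F 1) = tail F.
Proof.
apply/funext => x; rewrite /nconvol/= tail_convol tailE; apply: Ex_eq => y.
by rewrite tailE Ex_dirac; [rewrite subr_lt0|bounded].
Qed.

Lemma mclip_nconvol F n A : 0 <= A -> on_nonneg F ->
  n%:R * mclip F (A / 2 ^+ n) <= mclip (nconvol F n) A <= n%:R * mclip F A.
Proof.
move=> A0 F0; elim: n A A0 => [|n IHn] A A0.
  rewrite !mul0r /mclip Ex_dirac; last exact: bdm_clip1.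
  by rewrite clip_ge0//=; case: (clipP 0 A0) => ?; lra.
have A20 : 0 <= A / 2 by lra.
have /andP[lo hi] := mclip_convol A0 F0 (on_nonneg_nconvol n F0).
have /andP[lo2 _] := IHn _ A20; have /andP[_ hi2] := IHn _ A0.
have -> : A / 2 ^+ n.+1 = A / 2 / 2 ^+ n by rewrite exprS invfM mulrA.
have : mclip F (A / 2 / 2 ^+ n) <= mclip F (A / 2).
  apply: le_mclip; first by rewrite divr_ge0 ?exprn_ge0.
  by rewrite ler_pdivrMr ?exprn_gt0// ler_peMr// exprn_ege1// ler1n.
have -> : n.+1%:R = n%:R + 1 :> R by rewrite natr1.
rewrite [nconvol F n.+1]/(convol F (nconvol F n)) !mulrDl !mul1r => le2.
by apply/andP; split; lra.
Qed.

(** The law does not charge the negative half-line, so the mean is the integral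
    of a nonnegative function, to which monotone convergence applies. *)
Lemma mean_max F : on_nonneg F -> mean F = (\int[F]_y (Num.max (y : R) 0)%:E)%E.
Proof.
move=> F0; rewrite /mean unlock; apply: ae_eq_integral => //.
  by apply/measurable_EFinP; meas.
exists `]-oo, 0[%classic; split; first exact: measurable_itv.
- rewrite -setCitvr.
  exact: (@probability_setC0 R _ mR F _ _ F0).
- move=> y /=; rewrite in_itv/=; apply: contra_notP => /negP; rewrite -leNgt.
  by move=> y0 _; rewrite (max_idPl y0).
Qed.

Lemma mclip_le_mean F A : on_nonneg F -> (mean F < +oo)%E -> 0 <= A ->
  mclip F A <= fine (mean F).
Proof.
move=> F0 Foo A0; have m0 : (0 <= mean F)%E.
  by rewrite mean_max//; apply: integral_ge0 => y _; rewrite lee_fin le_max lexx orbT.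
have mfin : mean F \is a fin_num by rewrite ge0_fin_numE.
rewrite -lee_fin (fineK mfin) mean_max// EFin_Ex; last exact: bdm_clip1.
apply: ge0_le_integral => //.
- by move=> y _; rewrite lee_fin clip_ge0.
- by apply/measurable_EFinP; case: (bdm_clip1 A0).
- by apply/measurable_EFinP; meas.
- by move=> y _; rewrite lee_fin ge_min lexx.
Qed.

Lemma cvg_mclip F : on_nonneg F -> (mean F < +oo)%E ->
  mclip F n%:R @[n --> \oo] --> fine (mean F).
Proof.
move=> F0 Foo; have m0 : (0 <= mean F)%E.
  by rewrite mean_max//; apply: integral_ge0 => y _; rewrite lee_fin le_max lexx orbT.
have mfin : mean F \is a fin_num by rewrite ge0_fin_numE.
suff h : (\int[F]_y (clip n%:R (y : R))%:E)%E @[n --> \oo] --> (fine (mean F))%:E.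
  exact: fine_cvg h.
rewrite (fineK mfin) mean_max//.
have lim y : limn (fun n => (clip n%:R (y : R))%:E) = (Num.max (y : R) 0)%:E.
  apply/cvg_lim => //; apply: cvg_near_cst.
  exists (Num.truncn `|y|).+1 => // n /= yn; congr (_%:E); apply/min_idPl.
  have := ltW (truncnS_gt `|y|); rewrite -(ler_nat R) in yn; rewrite ge_max.
  by move=> /le_trans/(_ yn)/(le_trans (ler_norm y)) ->; exact: ler0n.
under [X in _ --> X]eq_integral => y _ do rewrite -lim.
apply: cvg_monotone_convergence => //.
- move=> n; apply/measurable_EFinP; case: (bdm_clip1 (ler0n R n)) => //.
- by move=> n y _; rewrite lee_fin clip_ge0.
move=> y _ n p np; rewrite lee_fin.
rewrite -(ler_nat R) in np.
by case: (clipP y (ler0n R n)) => ?; case: (clipP y (ler0n R p)) => ?; lra.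
Qed.

Lemma mclip_near_mean F e : on_nonneg F -> (mean F < +oo)%E -> 0 < e ->
  \forall A \near +oo, fine (mean F) - e <= mclip F A.
Proof.
move=> F0 Foo e0.
have /cvgrPdist_le/(_ _ e0)[N _ /(_ N (leqnn N))/=] := cvg_mclip F0 Foo.
rewrite ler_norml => /andP[_ NF].
exists N%:R; split => // A /ltW NA.
have := le_mclip F (ler0n _ N) NA; lra.
Qed.

Lemma markov_tail F A : 0 <= A -> A * tail F A <= mclip F A.
Proof.
move=> A0; rewrite tailE -ExZ; last by bounded.
apply: Ex_le; [by bounded|exact: bdm_clip1|move=> y].
by case: (clipP y A0) => ?; case: ltP => ? /=; lra.
Qed.

End clipped_mean.
(** * Local behaviour of long-tailed laws *)

Section long_tailed.
Context {R : realType}.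
Variable F : law R.
Hypothesis Llt : forall t : R, 0 < t -> local_long_tailed t F.
Implicit Types (x y u t e h : R).
Local Notation f x := (incr F x (x + 1)).

Lemma near_shift (P : R -> Prop) (c : R) :
  (\forall x \near +oo, P x) -> \forall x \near +oo, P (x + c).
Proof. by move=> nP; exact: (cvg_addrr c). Qed.

Lemma cvg_shift (g : R -> R) (c l : R) :
  g x @[x --> +oo] --> l -> g (x + c) @[x --> +oo] --> l.
Proof. by move=> gl; apply: cvg_comp gl; exact: cvg_addrr. Qed.

Lemma long_tailed_cvg t y : 0 < t -> 0 <= y <= 1 ->
  incr F (x + y) (x + y + t) / incr F x (x + t) @[x --> +oo] --> (1 : R).
Proof.
move=> t0 y01; apply/cvgrPdist_le => e e0.
apply: (Llt t0 : _ `=>` _) [set g : R -> R | `|1 - g y| <= e] _.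
apply/uniform_nbhs.
exists [set z : R * R | `|z.1 - z.2| <= e]; split.
  exists e => //= z; rewrite /ball_/=; exact: ltW.
by move=> g /(_ y); apply; rewrite /= in_itv.
Qed.

Lemma incr_gt0_near t : 0 < t -> \forall x \near +oo, 0 < incr F x (x + t).
Proof.
move=> t0; have := @long_tailed_cvg t 0 t0; rewrite lexx ler01 => /(_ isT).
move=> /cvgrPdist_lt/(_ _ ltr01); apply: filterS => x.
rewrite lt0r incr_ge0 ?lerDl ?ltW// andbT; apply: contraTneq => ->.
by rewrite invr0 mulr0 subr0 normr1 ltxx.
Qed.

(** Chaining the one-step relation k times; the steps have length h <= 1, within
    the range of shifts that long-tailedness controls. *)
Lemma long_tailed_cvg_mul h k : 0 < h <= 1 ->
  incr F (x + k%:R * h) (x + k%:R * h + h) / incr F x (x + h) @[x --> +oo]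
  --> (1 : R).
Proof.
move=> /andP[h0 h1]; have h01 : 0 <= h <= 1 by rewrite ltW.
elim: k => [|k IHk]; first by apply: long_tailed_cvg; rewrite // mul0r lexx ler01.
have := @cvgM _ _ _ _ _ _ _ _
  (cvg_shift (k%:R * h) (long_tailed_cvg h0 h01)) IHk => /(_ _).
rewrite mulr1; apply: cvg_trans; apply: near_eq_cvg.
near=> x; have : 0 < incr F (x + k%:R * h) (x + k%:R * h + h).
  by near: x; apply: (near_shift (k%:R * h) (incr_gt0_near h0)).
move=> q0 /=.
have -> : x + k.+1%:R * h = x + k%:R * h + h by ring.
by rewrite mulrA mulfVK ?gt_eqF.
Unshelve. all: by end_near. Qed.

Lemma incr_cvg_mul h k : 0 < h <= 1 ->
  incr F x (x + k%:R * h) / incr F x (x + h) @[x --> +oo] --> (k%:R : R).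
Proof.
move=> h01; elim: k => [|k IHk].
  under eq_fun do rewrite mul0r addr0 /incr subrr mul0r.
  exact: cvg_cst.
have := @cvgD _ _ _ _ _ _ _ _ _ IHk (long_tailed_cvg_mul k h01) => /(_ _); rewrite natr1.
apply: cvg_trans; apply: near_eq_cvg; apply: nearW => x /=.
have -> : x + k.+1%:R * h = x + k%:R * h + h by ring.
by apply: (etrans (esym (mulrDl _ _ _))); rewrite /incr; congr (_ / _); ring.
Qed.

(** The window (x, x + 1] splits into m + 1 cells of asymptotically equal mass,
    so k cells carry the fraction k / (m + 1) of it. *)
Lemma incr_cvg_grid (m k : nat) :
  incr F x (x + k%:R / m.+1%:R) / f x @[x --> +oo] --> (k%:R / m.+1%:R : R).
Proof.
have h01 : 0 < (m.+1%:R^-1 : R) <= 1.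
  by rewrite invr_gt0 ltr0n/= invf_le1 ?ler1n ?ltr0n.
have := @cvgM _ _ _ _ _ _ _ _
  (@incr_cvg_mul _ k h01) (@cvgV _ _ _ _ _ _ _ (@incr_cvg_mul _ m.+1 h01)).
rewrite pnatr_eq0 => /(_ _ _ isT); apply: cvg_trans; apply: near_eq_cvg.
near=> x; have q0 : 0 < incr F x (x + m.+1%:R^-1).
  by near: x; apply: incr_gt0_near; case/andP: h01.
by rewrite /= invf_div mulrA mulfVK ?gt_eqF// divff// pnatr_eq0.
Unshelve. all: by end_near. Qed.

Lemma near_le_all (P : nat -> R -> Prop) K :
  (forall k, \forall x \near +oo, P k x) ->
  \forall x \near +oo, forall k, (k <= K)%N -> P k x.
Proof.
move=> nP; have : \forall x \near +oo, forall i : 'I_K.+1, P i x.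
  by apply: filter_forall => i; exact: nP.
apply: filterS.
by move=> x Px k kK; exact: (Px (Ordinal (kK : k < K.+1)%N)).
Qed.

(** Pointwise convergence of monotone functions to a continuous one is locally
    uniform: compare u with the neighbouring points of a fine grid. *)
Lemma incr_uniform_ge0 (A : R) e : 0 <= A -> 0 < e ->
  \forall x \near +oo, forall u, 0 <= u <= A ->
    `|incr F x (x + u) - u * f x| <= e * f x.
Proof.
move=> A0 e0.
pose m := Num.truncn (2 / e); pose h : R := m.+1%:R^-1.
have h0 : 0 < h by rewrite invr_gt0 ltr0n.
have mh : m.+1%:R * h = 1 by rewrite mulfV// pnatr_eq0.
have he : h <= e / 2.
  rewrite /h -[leRHS]invrK lef_pV2 ?posrE ?ltr0n ?invr_gt0 ?divr_gt0//.
  by rewrite invfM invrK mulrC; exact: ltW (truncnS_gt _).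
pose K := (Num.truncn (A * m.+1%:R)).+1.
have e20 : 0 < e / 2 by lra.
have /(@near_le_all _ K) grid k : \forall x \near +oo,
    `|incr F x (x + k%:R * h) - k%:R * h * f x| <= e / 2 * f x.
  have /cvgrPdist_le/(_ _ e20) := @incr_cvg_grid m k; rewrite -/h => nk.
  near=> x; have f0 : 0 < f x by near: x; exact: incr_gt0_near.
  rewrite -(mulfVK (lt0r_neq0 f0) (incr F x (x + k%:R * h))) -mulrBl.
  by rewrite normrM (gtr0_norm f0) ler_pM2r// distrC; near: x.
near=> x => u /andP[u0 uA].
have f0 : 0 < f x by near: x; exact: incr_gt0_near.
have gr : forall k, (k <= K)%N ->
  `|incr F x (x + k%:R * h) - k%:R * h * f x| <= e / 2 * f x by near: x.
have um0 : 0 <= u * m.+1%:R by rewrite mulr_ge0.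
pose k := Num.truncn (u * m.+1%:R).
have kK : (k < K)%N.
  by rewrite ltnS /k /K; apply: le_truncn; rewrite ler_wpM2r.
have /andP[ku uk] : k%:R * h <= u < k.+1%:R * h.
  have := truncn_itv um0; rewrite -/k -(ler_pM2r h0) -(ltr_pM2r h0) -mulrA mh.
  by rewrite mulr1.
have incle v w : v <= w -> incr F x (x + v) <= incr F x (x + w).
  move=> vw; rewrite !incr_tail lerD2l lerN2; apply: le_tail.
  by rewrite lerD2l.
have := gr k (ltnW kK); have := gr k.+1 kK; rewrite !ler_norml.
have := incle _ _ ku; have := incle _ _ (ltW uk).
have := ler_wpM2r (ltW f0) ku; have := ler_wpM2r (ltW f0) (ltW uk).
have := ler_wpM2r (ltW f0) he.
have kS : k.+1%:R = k%:R + 1 :> R by rewrite natr1.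
by rewrite kS !mulrDl !mul1r; lra.
Unshelve. all: by end_near. Qed.


(** On windows of bounded size around x, F is f(x) times Lebesgue measure up to
    o(f(x)).  Negative u reduce to nonnegative ones by moving the base point to
    x - B. *)
Lemma incr_uniform (A : R) e : 0 < e ->
  \forall x \near +oo, forall u, `|u| <= A ->
    `|incr F x (x + u) - u * f x| <= e * f x.
Proof.
move=> e0; pose B := Num.max A 1.
have B1 : 1 <= B by rewrite le_max lexx orbT.
have AB : A <= B by rewrite le_max lexx.
pose d := Num.min (e / (4 * (B + 1))) (1 / 4).
have d0 : 0 < d by rewrite lt_min !divr_gt0//; lra.
have de : d * (4 * (B + 1)) <= e.
  by rewrite -ler_pdivlMr ?ge_min ?lexx//; lra.
have d4 : d <= 1 / 4 by rewrite ge_min lexx orbT.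
have B0 : 0 <= 2 * B by lra.
near=> x => u uA.
have f0 : 0 < f (x - B) by near: x; apply: (near_shift (- B) (incr_gt0_near ltr01)).
have key : forall v, 0 <= v <= 2 * B ->
    `|incr F (x - B) (x - B + v) - v * f (x - B)| <= d * f (x - B).
  by near: x; apply: (near_shift (- B) (incr_uniform_ge0 B0 d0)).
set g := f (x - B) in f0 key.
have uB : `|u| <= B by exact: le_trans AB.
have /andP[uB1 uB2] : - B <= u <= B by rewrite -ler_norml.
have /key : 0 <= u + B <= 2 * B by lra.
have /key : 0 <= B <= 2 * B by lra.
have /key : 0 <= B + 1 <= 2 * B by lra.
have -> : x - B + (u + B) = x + u by ring.
have -> : x - B + (B + 1) = x + 1 by ring.
have -> : x - B + B = x by ring.
have -> : incr F x (x + u) = incr F (x - B) (x + u) - incr F (x - B) x.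
  by rewrite /incr; ring.
have -> : f x = incr F (x - B) (x + 1) - incr F (x - B) x by rewrite /incr; ring.
move: (incr _ _ (x + u)) (incr _ _ (x + 1)) (incr _ _ x) => a b c.
rewrite !ler_norml => b2 c2 a2.
have {a2} au : `|a - c - u * g| <= 2 * d * g by rewrite ler_norml; lra.
have {b2 c2} bg : `|b - c - g| <= 2 * d * g by rewrite ler_norml; lra.
have ub : `|u * (b - c) - u * g| <= B * (2 * d * g).
  by rewrite -mulrBr normrM; apply: ler_pM.
have dg : d * g <= 1 / 4 * g by rewrite ler_wpM2r// ltW.
have edg : d * (4 * (B + 1)) * g <= e * g by rewrite ler_wpM2r// ltW.
have gb : g <= 2 * (b - c) by move: bg; rewrite ler_norml; lra.
have egb : e * g <= e * (2 * (b - c)) by rewrite ler_wpM2l// ltW.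
move: au ub; rewrite !ler_norml; lra.
Unshelve. all: by end_near. Qed.

End long_tailed.
(** * One-sided asymptotic comparison *)

Section asymptotics.
Context {R : realType}.
Implicit Types (a b f : R -> R) (c k e : R).

(** One-sided halves of the equivalence of a with c f, in the sense
    liminf a / f >= c and limsup a / f <= c for eventually positive f. *)
Definition asym_ge a f c :=
  forall e, 0 < e -> \forall x \near +oo, (c - e) * f x <= a x.

Definition asym_le a f c :=
  forall e, 0 < e -> \forall x \near +oo, a x <= (c + e) * f x.

Lemma asym_eqP a f c : 0 < c -> (\forall x \near +oo, 0 < f x) ->
  asym_eq a (fun x => c * f x) <-> asym_ge a f c /\ asym_le a f c.
Proof.
move=> c0 fpos; split=> [/cvgrPdist_le af|[lo hi]].
  have af' e : 0 < e -> \forall x \near +oo, `|c * f x - a x| <= e * f x.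
    move=> e0; have ec0 : 0 < e / c by rewrite divr_gt0.
    near=> x; have fx : 0 < f x by near: x.
    have cf0 : c * f x != 0 by rewrite mulf_neq0 ?gt_eqF.
    have -> : c * f x - a x = (1 - a x / (c * f x)) * (c * f x).
      by rewrite mulrBl mul1r mulfVK.
    have -> : e * f x = e / c * (c * f x) by rewrite mulrA mulfVK ?gt_eqF.
    rewrite normrM (gtr0_norm (mulr_gt0 c0 fx)) ler_pM2r ?mulr_gt0//.
    by near: x; exact: af.
  split=> e e0; near=> x.
    have : `|c * f x - a x| <= e * f x by near: x; exact: af'.
    by rewrite ler_norml mulrBl; lra.
  have : `|c * f x - a x| <= e * f x by near: x; exact: af'.
  by rewrite ler_norml mulrDl; lra.
apply/cvgrPdist_le => e e0; have ec0 : 0 < e * c by rewrite mulr_gt0.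
near=> x; have fx : 0 < f x by near: x.
have cf0 : 0 < c * f x by rewrite mulr_gt0.
have -> : 1 - a x / (c * f x) = (c * f x - a x) / (c * f x).
  by rewrite mulrBl divff ?gt_eqF.
rewrite normrM normfV (gtr0_norm cf0) ler_pdivrMr// ler_norml.
have l : (c - e * c) * f x <= a x by near: x; exact: lo.
have h : a x <= (c + e * c) * f x by near: x; exact: hi.
move: l h; rewrite mulrBl mulrDl; lra.
Unshelve. all: by end_near. Qed.

Lemma asym_geD a b f c c' k : 0 <= k -> asym_ge a f c -> asym_ge b f c' ->
  asym_ge (fun x => a x + k * b x) f (c + k * c').
Proof.
move=> k0 af bf e e0; have e20 : 0 < e / 2 by lra.
have k1 : 0 < k + 1 by lra.
pose d := e / 2 / (k + 1); have d0 : 0 < d by exact: divr_gt0.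
have dE : d * (k + 1) = e / 2 by rewrite mulfVK ?gt_eqF.
near=> x.
have ax : (c - (e / 2 + d)) * f x <= a x by near: x; apply: af; exact: addr_gt0.
have bx : (c' - d) * f x <= b x by near: x; exact: bf.
have := ler_wpM2l k0 bx.
have -> : e = d * (k + 1) + e / 2 by rewrite dE; lra.
by lra.
Unshelve. all: by end_near. Qed.

Lemma asym_leD a b f c c' k : 0 <= k -> asym_le a f c -> asym_le b f c' ->
  asym_le (fun x => a x + k * b x) f (c + k * c').
Proof.
move=> k0 af bf e e0; have e20 : 0 < e / 2 by lra.
have k1 : 0 < k + 1 by lra.
pose d := e / 2 / (k + 1); have d0 : 0 < d by exact: divr_gt0.
have dE : d * (k + 1) = e / 2 by rewrite mulfVK ?gt_eqF.
near=> x.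
have ax : a x <= (c + (e / 2 + d)) * f x by near: x; apply: af; exact: addr_gt0.
have bx : b x <= (c' + d) * f x by near: x; exact: bf.
have := ler_wpM2l k0 bx.
have -> : e = d * (k + 1) + e / 2 by rewrite dE; lra.
by lra.
Unshelve. all: by end_near. Qed.

Lemma asym_le_cancel a b f c c' k : 0 < k ->
  asym_le (fun x => a x + k * b x) f (c + k * c') -> asym_ge a f c ->
  asym_le b f c'.
Proof.
move=> k0 abf af e e0; pose d := k * e / 2.
have d0 : 0 < d by rewrite divr_gt0 ?mulr_gt0.
near=> x; rewrite -(ler_pM2l k0).
have ax : (c - d) * f x <= a x by near: x; exact: af.
have abx : a x + k * b x <= (c + k * c' + d) * f x by near: x; exact: abf.
have -> : k * ((c' + e) * f x) = (k * c' + 2 * d) * f x by rewrite /d; field.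
by lra.
Unshelve. all: by end_near. Qed.

End asymptotics.
(** * The excess of convolution tails *)

Section excess.
Context {R : realType}.
Variable F : law R.
Hypothesis Llt : forall t : R, 0 < t -> local_long_tailed t F.
Hypothesis F0 : on_nonneg F.
Hypothesis Foo : (mean F < +oo)%E.
Implicit Types (G : law R) (x y u t e A : R).
Local Notation mR := (measurableTypeR R).
Local Notation mu := (fine (mean F)).
Let f x := incr F x (x + 1).

Let f_gt0 : \forall x \near +oo, 0 < f x.
Proof. exact: incr_gt0_near. Qed.

(** F charges (x, x + 1] for some x >= 1. *)
Lemma mean_gt0 : 0 < mu.
Proof.
near (pinfty_nbhs R) => x.
have fx : 0 < f x by near: x.
have x1 : 1 <= x by near: x; apply: nbhs_pinfty_ge; exact: num_real.
have := mclip_le_mean F0 Foo (le_trans ler01 x1).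
have := markov_tail F (le_trans ler01 x1).
have : tail F x <= x * tail F x by rewrite ler_peMl// tail_ge0.
have := tail_ge0 F (x + 1); move: fx; rewrite /f incr_tail; lra.
Unshelve. all: by end_near. Qed.

(** From Markov's inequality for the clipped mean. *)
Lemma tail_near0 e : 0 < e -> \forall A \near +oo, tail F A <= e.
Proof.
move=> e0; near=> A.
have A0 : 0 < A by near: A; apply: nbhs_pinfty_gt; exact: num_real.
have Ae : mu / e <= A by near: A; apply: nbhs_pinfty_ge; exact: num_real.
rewrite -(ler_pM2l A0) (le_trans (markov_tail F (ltW A0)))//.
by rewrite (le_trans (mclip_le_mean F0 Foo (ltW A0)))// -ler_pdivrMr.
Unshelve. all: by end_near. Qed.

Lemma near_pinfty_div_exp2 (P : R -> Prop) n :
  (\forall A \near +oo, P A) -> \forall A \near +oo, P (A / 2 ^+ n).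
Proof.
elim: n => [|n IHn] nP; first by near do rewrite expr0 divr1.
near=> A; rewrite exprS invfM mulrA; near: A.
exact: (near_pinfty_div2 (IHn nP)).
Unshelve. all: by end_near. Qed.

(** The two bounds of [mclip_nconvol] have the common limit n mu. *)
Lemma mclip_nconvol_diff n e : 0 < e ->
  \forall A \near +oo, `|mclip (nconvol F n) A - n%:R * mclip F A| <= e.
Proof.
move=> e0; have en : 0 < e / n.+1%:R by rewrite divr_gt0.
have : \forall A \near +oo, mu - e / n.+1%:R <= mclip F (A / 2 ^+ n).
  apply: (@near_pinfty_div_exp2 (fun A => mu - e / n.+1%:R <= mclip F A)).
  exact: mclip_near_mean.
move=> nA; near=> A.
have A0 : 0 <= A by near: A; apply: nbhs_pinfty_ge; exact: num_real.
have := mclip_nconvol n A0 F0; have := mclip_le_mean F0 Foo A0.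
have : mu - e / n.+1%:R <= mclip F (A / 2 ^+ n) by near: A.
have : n%:R * (e / n.+1%:R) <= e.
  by rewrite mulrCA ler_piMr ?ltW// ltr_pdivrMr// mul1r ltr_nat.
move=> ne m1 m2 /andP[lo hi]; have n0 := ler0n R n.
move: (e / n.+1%:R) (mclip F (A / 2 ^+ n)) ne m1 lo => d m ne m1 lo.
have := ler_wpM2l n0 m1; have := ler_wpM2l n0 m2; rewrite ler_norml mulrBr; lra.
Unshelve. all: by end_near. Qed.

Lemma long_tailed_shift A e : 0 < e ->
  \forall x \near +oo, forall y, `|y| <= A -> `|f (x - y) - f x| <= e * f x.
Proof.
move=> e0; have e20 : 0 < e / 2 by lra.
near=> x => y yA.
have key : forall u, `|u| <= A + 1 -> `|incr F x (x + u) - u * f x| <= e / 2 * f x.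
  by near: x; exact: incr_uniform.
have y1 : `|- y| <= A + 1 by rewrite normrN; lra.
have /key : `|1 - y| <= A + 1.
  by rewrite (le_trans (ler_normB _ _))// normr1; lra.
have := key _ y1.
rewrite /f (_ : x + (1 - y) = x - y + 1); last by ring.
by rewrite !ler_norml /incr; lra.
Unshelve. all: by end_near. Qed.

Lemma bdm_clip_incr A x : 0 <= A -> bdm (fun s : mR => incr F (x - clip A s) x).
Proof.
move=> A0; have -> : (fun s : mR => incr F (x - clip A s) x) =
    (fun s : mR => tail F (x - clip A s) - tail F x).
  by apply/funext => s; exact: incr_tail.
apply: bdmB; last exact: bdm_cst.
apply: (bdm_comp (k := fun s : mR => (x - clip A s : mR))) (bdm_tail F).
by apply: measurable_funB; [meas|case: (bdm_clip1 A0)].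
Qed.

(** By [incr_uniform] with u = - clip A s, uniformly in s. *)
Lemma overshoot_near G A e : 0 <= A -> 0 < e -> \forall x \near +oo,
  `|Ex G (fun s : mR => incr F (x - clip A s) x) - mclip G A * f x| <= e * f x.
Proof.
move=> A0 e0; near=> x.
have key : forall u, `|u| <= A -> `|incr F x (x + u) - u * f x| <= e * f x.
  by near: x; exact: incr_uniform.
have bc := bdm_clip1 A0; have bi := bdm_clip_incr x A0.
have bf : bdm (fun s : mR => f x * clip A s) by bounded.
have -> : mclip G A * f x = Ex G (fun s : mR => f x * clip A s).
  by rewrite mulrC ExZ.
rewrite -ExB// ler_norml -{1}(Ex_cst G (- (e * f x))) -{2}(Ex_cst G (e * f x)).
have le s : `|incr F (x - clip A s) x - f x * clip A s| <= e * f x.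
  have /key : `|- clip A s| <= A.
    by rewrite normrN ger0_norm ?clip_ge0// clip_le.
  rewrite (_ : incr F x (x - clip A s) = - incr F (x - clip A s) x); last first.
    by rewrite /incr opprB.
  by rewrite mulNr opprK addrC distrC mulrC.
have bd := bdmB bi bf.
have le' s : - (e * f x) <= incr F (x - clip A s) x - f x * clip A s <= e * f x.
  by rewrite -ler_norml; exact: le.
apply/andP; split.
  by apply: Ex_le => // [|s]; [exact: bdm_cst|have /andP[] := le' s].
by apply: Ex_le => // [|s]; [exact: bdm_cst|have /andP[] := le' s].
Unshelve. all: by end_near. Qed.

(** What the tail of the sum has beyond the contribution of a single large
    summand. *)
Definition excess n x := tail (nconvol F n) x - n%:R * tail F x.

Lemma bdm_excess n x : bdm (fun y : mR => excess n (x - y)).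
Proof.
rewrite /excess; apply: bdmB; first exact: bdm_tail_shift.
by apply: bdmM; [exact: bdm_cst|exact: bdm_tail_shift].
Qed.

(** E[excess n (x - X); X <= x]: the part of the recursion that inherits its
    asymptotics from [excess n]. *)
Definition excess_smoothed n x :=
  Ex F (fun y : mR => [ind (y : R) <= x] * excess n (x - y)).

(** For X > x both tails at x - X equal 1; these terms cancel against the
    contribution of one large summand on the left. *)
Lemma excess_rec n x : excess n.+1 x = excess_smoothed n x + n%:R * excess 2 x.
Proof.
have b1 : bdm (fun y : mR => [ind (y : R) <= x] * excess n (x - y)).
  by apply: bdmM; [bounded|exact: bdm_excess].
have bt := bdm_tail_shift F x.
have b2 : bdm (fun y : mR => n%:R * tail F (x - y)) by bounded.
have bi : bdm (fun y : mR => [ind x < (y : R)] : R) by bounded.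
have b3 := bdmM (bdm_cst (n%:R - 1)) bi.
rewrite /excess_smoothed /excess [nconvol F n.+1]/(convol F (nconvol F n)).
rewrite [nconvol F 2]/(convol F (nconvol F 1)) !tail_convol tail_nconvol1.
have -> : Ex F (fun y : mR => tail (nconvol F n) (x - y)) =
    Ex F (fun y : mR => [ind (y : R) <= x] * excess n (x - y) +
      n%:R * tail F (x - y) - (n%:R - 1) * [ind x < (y : R)]).
  apply: Ex_eq => y; rewrite /excess; case: (leP (y : R) x) => yx /=; first by ring.
  have xy0 : x - y < 0 by rewrite subr_lt0.
  by rewrite !tail_lt0//; [ring|exact: on_nonneg_nconvol].
rewrite ExB//; last exact: bdmD.
rewrite (ExD F b1 b2) (ExZ F n%:R bt) (ExZ F (n%:R - 1) bi) -tailE.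
rewrite -[n.+1%:R]natr1 /excess; ring.
Qed.

(** The part x - A < X <= x is rewritten by [overshoot] for S_n and for X. *)
Lemma excess_smoothed_split n A x : 0 <= A -> excess_smoothed n x =
  Ex F (fun y : mR => [ind (y : R) <= x - A] * excess n (x - y)) +
  (Ex (nconvol F n) (fun s : mR => incr F (x - clip A s) x) -
   n%:R * Ex F (fun s : mR => incr F (x - clip A s) x)).
Proof.
move=> A0; rewrite -!overshoot//.
have be := bdm_excess n x.
have bt := bdm_tail_shift F x; have bn := bdm_tail_shift (nconvol F n) x.
have bi : bdm (fun y : mR => [ind (x - A < (y : R)) && ((y : R) <= x)] : R) by bounded.
rewrite -ExZ; last exact: bdmM.
rewrite -ExB; [|exact: bdmM|by apply: bdmM; [bounded|exact: bdmM]].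
rewrite -ExD; [|by apply: bdmM; bounded|]; last first.
  by apply: bdmB; [exact: bdmM|by apply: bdmM; [bounded|exact: bdmM]].
apply: Ex_eq => y; rewrite /excess; case: (leP (y : R) (x - A)) => yA /=.
  by rewrite (_ : (y : R) <= x) /=; [ring|lra].
by ring.
Qed.


(** By [overshoot_near] the difference is about
    f(x) (E[min(S_n, A)] - n E[min(X, A)]), and clipped means become additive as
    A grows. *)
Lemma overshoot_diff_near n e : 0 < e ->
  \forall A \near +oo, \forall x \near +oo,
  `|Ex (nconvol F n) (fun s : mR => incr F (x - clip A s) x) -
    n%:R * Ex F (fun s : mR => incr F (x - clip A s) x)| <= e * f x.
Proof.
move=> e0; pose d := e / 3 / n.+1%:R.
have e30 : 0 < e / 3 by lra.
have d0 : 0 < d by rewrite divr_gt0.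
have nd : n%:R * d <= e / 3.
  by rewrite mulrCA ler_piMr ?ltW// ltr_pdivrMr// mul1r ltr_nat.
near=> A; have A0 : 0 <= A by near: A; apply: nbhs_pinfty_ge; exact: num_real.
have md : `|mclip (nconvol F n) A - n%:R * mclip F A| <= e / 3.
  by near: A; exact: mclip_nconvol_diff.
near=> x; have fx : 0 < f x by near: x.
have : `|Ex (nconvol F n) (fun s : mR => incr F (x - clip A s) x) -
    mclip (nconvol F n) A * f x| <= e / 3 * f x by near: x; exact: overshoot_near.
have : `|Ex F (fun s : mR => incr F (x - clip A s) x) -
    mclip F A * f x| <= d * f x by near: x; exact: overshoot_near.
move: (Ex _ _) (Ex _ _) (mclip _ _) (mclip _ _) md => a b p q pq aq.
have {}aq : `|n%:R * b - n%:R * p * f x| <= e / 3 * f x.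
  rewrite -mulrA -mulrBr normrM normr_nat.
  by rewrite (le_trans (ler_wpM2l (ler0n _ _) aq))// mulrA ler_wpM2r// ltW.
have {}pq : `|q * f x - n%:R * p * f x| <= e / 3 * f x.
  by rewrite -mulrBl normrM (gtr0_norm fx) ler_wpM2r// ltW.
by move: aq pq; rewrite !ler_norml; lra.
Unshelve. all: by end_near. Qed.

Lemma bdm_ind_f A x : bdm (fun y : mR => [ind (y : R) <= A] * f (x - y)).
Proof. exact: bdm_ind_incr. Qed.

(** For X in [0, A], an event of probability close to 1, f(x - X) is close to
    f(x). *)
Lemma small_part_ge e : 0 < e -> \forall A \near +oo, \forall x \near +oo,
  (1 - e) * f x <= Ex F (fun s : mR => [ind (s : R) <= A] * f (x - s)).
Proof.
move=> e0; pose d := Num.min (e / 2) 1.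
have d0 : 0 < d by rewrite lt_min; lra.
have d1 : d <= 1 by rewrite ge_min lexx orbT.
have de : d <= e / 2 by rewrite ge_min lexx.
near=> A.
have tA : tail F A <= d by near: A; exact: tail_near0.
near=> x; have fx : 0 < f x by near: x.
have fs : forall y, `|y| <= A -> `|f (x - y) - f x| <= d * f x.
  by near: x; exact: long_tailed_shift.
have bi : bdm (fun s : mR => [ind (s : R) <= A] : R) by bounded.
apply: (@le_trans _ _ (Ex F (fun s : mR => (1 - d) * f x * [ind (s : R) <= A]))).
  rewrite ExZ// -dfE (_ : df F A = 1 - tail F A); last by rewrite /tail; ring.
  rewrite mulrAC ler_wpM2r//; first exact: ltW.
  have : (1 - d) * (1 - d) <= (1 - d) * (1 - tail F A).
    by rewrite ler_wpM2l//; lra.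
  have := mulr_ge0 (ltW d0) (ltW d0); lra.
apply: Ex_le_nonneg => //; [|exact: bdm_ind_f|move=> s s0].
  by apply: bdmM; [exact: bdm_cst|].
case: (leP s A) => sA /=; last by rewrite mulr0 mul0r.
have /fs : `|s| <= A by rewrite ger0_norm.
by rewrite ler_norml mulr1 mul1r; lra.
Unshelve. all: by end_near. Qed.

Lemma near_pinfty_unfold (P : R -> Prop) : (\forall x \near +oo, P x) ->
  exists M, forall x, M < x -> P x.
Proof. by move=> [M [_ MP]]; exists M. Qed.

(** Positivity of c makes the integrand nonnegative on A < X <= x - A, so this
    range can be dropped. *)
Lemma excess_smoothed_ge n c : 0 < c ->
  asym_ge (excess n) f c -> asym_ge (excess_smoothed n) f c.
Proof.
move=> c0 Hn e e0.
(* d <= c keeps the coefficient c - d nonnegative. *)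
pose d := Num.min (e / 4) c.
have d0 : 0 < d by rewrite lt_min c0 andbT; lra.
have dc : d <= c by rewrite ge_min lexx orbT.
have de : d <= e / 4 by rewrite ge_min lexx.
have [M HM] := near_pinfty_unfold (Hn _ d0).
pose h := e / (4 * c); have h0 : 0 < h by rewrite divr_gt0//; lra.
have hc : c * h <= e / 4.
  by rewrite (_ : c * h = e / 4)// /h; field; exact: lt0r_neq0.
have e40 : 0 < e / 4 by lra.
(* A is fixed first, large enough for all the estimates as x tends to +oo. *)
near (pinfty_nbhs R) => A.
have A0 : 0 <= A by near: A; apply: nbhs_pinfty_ge; exact: num_real.
have MA : M < A by near: A; apply: nbhs_pinfty_gt; exact: num_real.
near=> x; have fx : 0 < f x by near: x.
have x2A : 2 * A <= x by near: x; apply: nbhs_pinfty_ge; exact: num_real.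
rewrite (excess_smoothed_split n x A0).
have ov : `|Ex (nconvol F n) (fun s : mR => incr F (x - clip A s) x) -
    n%:R * Ex F (fun s : mR => incr F (x - clip A s) x)| <= e / 4 * f x.
  by near: x; near: A; exact: overshoot_diff_near.
have sm : (1 - h) * f x <= Ex F (fun s : mR => [ind (s : R) <= A] * f (x - s)).
  by near: x; near: A; exact: small_part_ge.
have far : (c - d) * Ex F (fun s : mR => [ind (s : R) <= A] * f (x - s)) <=
    Ex F (fun y : mR => [ind (y : R) <= x - A] * excess n (x - y)).
  rewrite -ExZ; last exact: bdm_ind_f.
  apply: Ex_le => [||y].
  - by apply: bdmM; [exact: bdm_cst|exact: bdm_ind_f].
  - by apply: bdmM; [bounded|exact: bdm_excess].
  have ge0 : 0 <= (c - d) * f (x - y).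
    by apply: mulr_ge0; [rewrite subr_ge0|apply: incr_ge0; rewrite lerDl].
  have far2 : (y : R) <= x - A -> (c - d) * f (x - y) <= excess n (x - y).
    by move=> yx; apply: HM; move: y yx {ge0} => /= y; lra.
  case: (leP (y : R) A) => yA; case: (leP (y : R) (x - A)) => yxA /=.
  - by rewrite !mul1r; exact: far2.
  - by move: y yA yxA {ge0 far2} => /= y; lra.
  - by rewrite mul0r mulr0 mul1r; exact: le_trans (far2 yxA).
  - by rewrite !mul0r mulr0.
have cd0 : 0 <= c - d by lra.
have := ler_wpM2l cd0 sm.
have hcf : c * h * f x <= e / 4 * f x by rewrite ler_wpM2r// ltW.
have dhf := mulr_ge0 (mulr_ge0 (ltW d0) (ltW h0)) (ltW fx).
have def : d * f x <= e / 4 * f x by rewrite ler_wpM2r// ltW.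
move: ov; rewrite ler_norml; lra.
Unshelve. all: by end_near. Qed.


Lemma Ex_nconvol1 (g : mR -> R) : bdm g -> Ex (nconvol F 1) g = Ex F g.
Proof.
move=> bg; rewrite [nconvol F 1]/(convol F _) Ex_convol//.
apply: Ex_eq => y; rewrite Ex_dirac; first by rewrite addr0.
by apply: (bdm_comp (k := fun s : mR => (y : R) + (s : R) : mR)) bg; meas.
Qed.

Lemma incr_nconvol1 x y : incr (nconvol F 1) x y = incr F x y.
Proof. by rewrite !incr_tail tail_nconvol1. Qed.

(** The range X <= x - A carries at most (1 + o(1)) f(x) in E[f(x - X)]: by
    [convol_incr_ge], the total 2 f(x) of the second convolution power also has
    to accommodate the equally large range X' <= A. *)
Lemma excess_smoothed_le n c : 0 <= c ->
  asym_le (fun x => incr (nconvol F 2) x (x + 1)) f 2 ->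
  asym_le (excess n) f c -> asym_le (excess_smoothed n) f c.
Proof.
move=> c0 S2 Hn e e0; pose d := e / 4; have d0 : 0 < d by rewrite /d; lra.
have cd0 : 0 < c + d by lra.
have [M HM] := near_pinfty_unfold (Hn _ d0).
pose h := d / (c + d); have h0 : 0 < h by rewrite divr_gt0.
have hc : (c + d) * h = d by rewrite mulrC mulfVK ?gt_eqF.
(* A is fixed first, large enough for all the estimates as x tends to +oo. *)
near (pinfty_nbhs R) => A.
have A0 : 0 <= A by near: A; apply: nbhs_pinfty_ge; exact: num_real.
have MA : M < A by near: A; apply: nbhs_pinfty_gt; exact: num_real.
near=> x; have fx : 0 < f x by near: x.
rewrite (excess_smoothed_split n x A0).
have ov : `|Ex (nconvol F n) (fun s : mR => incr F (x - clip A s) x) -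
    n%:R * Ex F (fun s : mR => incr F (x - clip A s) x)| <= d * f x.
  by near: x; near: A; exact: overshoot_diff_near.
have sm : (1 - h) * f x <= Ex F (fun s : mR => [ind (s : R) <= A] * f (x - s)).
  by near: x; near: A; exact: small_part_ge.
have s2 : incr (nconvol F 2) x (x + 1) <= (2 + h) * f x by near: x; exact: S2.
have := convol_incr_ge F (nconvol F 1) A x ler01.
rewrite -[convol F _]/(nconvol F 2) Ex_nconvol1; last exact: bdm_ind_f.
have -> : (fun y : mR => [ind (y : R) <= x - A] *
      incr (nconvol F 1) (x - y) (x - y + 1)) =
    (fun y : mR => [ind (y : R) <= x - A] * f (x - y)).
  by apply/funext => y; rewrite incr_nconvol1.
move=> win.
have far : Ex F (fun y : mR => [ind (y : R) <= x - A] * excess n (x - y)) <=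
    (c + d) * Ex F (fun s : mR => [ind (s : R) <= x - A] * f (x - s)).
  rewrite -ExZ; last exact: bdm_ind_f.
  apply: Ex_le => [||y].
  - by apply: bdmM; [bounded|exact: bdm_excess].
  - by apply: bdmM; [exact: bdm_cst|exact: bdm_ind_f].
  case: (leP (y : R) (x - A)) => yxA /=; last by rewrite !mul0r mulr0.
  by rewrite !mul1r; apply: HM; move: y yxA => /= y; lra.
have big : Ex F (fun s : mR => [ind (s : R) <= x - A] * f (x - s)) <=
    (1 + 2 * h) * f x by move: win s2 sm; rewrite -/(f _); lra.
have := ler_wpM2l (ltW cd0) big.
have -> : (c + d) * ((1 + 2 * h) * f x) = (c + d + 2 * ((c + d) * h)) * f x by ring.
have eE : e = 4 * d by rewrite /d; lra.
rewrite hc eE; move: ov; rewrite ler_norml; lra.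
Unshelve. all: by end_near. Qed.

(** Each of the two ways in which one term exceeds x minus the other contributes
    f(x) E[min(X, A)], and their overlap is at most the squared tail at x - A,
    which is o(f(x)) as f(x - A) and f(x) are comparable. *)
Lemma excess2_ge : asym_o (fun x => tail F x ^+ 2) f ->
  asym_ge (excess 2) f (2 * mu).
Proof.
move=> /cvgr0Pnorm_le tf e e0; pose d := e / 6.
have d0 : 0 < d by rewrite /d; lra.
near (pinfty_nbhs R) => A.
have A0 : 0 <= A by near: A; apply: nbhs_pinfty_ge; exact: num_real.
have mA : mu - d <= mclip F A by near: A; exact: mclip_near_mean.
near=> x; have fx : 0 < f x by near: x.
have fxA : 0 < f (x - A) by near: x; apply: (near_shift (- A) f_gt0).
have fs : forall y, `|y| <= A -> `|f (x - y) - f x| <= 1 * f x.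
  by near: x; exact: long_tailed_shift.
have tA : `|tail F (x - A) ^+ 2 / f (x - A)| <= d.
  by near: x; apply: (near_shift (- A) (tf _ d0)).
have ov : `|Ex F (fun s : mR => incr F (x - clip A s) x) - mclip F A * f x| <=
    d * f x by near: x; exact: overshoot_near.
have := convol_tail_ge x F0 (on_nonneg_nconvol 1 F0) A0.
rewrite -[convol F _]/(nconvol F 2) tail_nconvol1.
have bt : bdm (fun s : mR => tail F (x - clip A s)).
  apply: (bdm_comp (k := fun s : mR => (x - clip A s : mR))) (bdm_tail F).
  by apply: measurable_funB; [meas|case: (bdm_clip1 A0)].
have -> : Ex (nconvol F 1) (fun s : mR => tail F (x - clip A s)) =
    Ex F (fun s : mR => tail F (x - clip A s)) by rewrite Ex_nconvol1.
have -> : Ex F (fun s : mR => tail F (x - clip A s)) =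
    Ex F (fun s : mR => incr F (x - clip A s) x) + tail F x.
  rewrite -{1}(Ex_cst F (tail F x)) -ExD; [|exact: bdm_clip_incr|exact: bdm_cst].
  by apply: Ex_eq => s; rewrite incr_tail subrK.
rewrite -expr2 /excess => lo.
have tsq : tail F (x - A) ^+ 2 <= 2 * d * f x.
  move: tA; rewrite ger0_norm; last first.
    by rewrite divr_ge0 ?sqr_ge0// ltW.
  rewrite ler_pdivrMr// => /le_trans; apply.
  have /fs : `|A| <= A by rewrite ger0_norm.
  rewrite ler_norml => /andP[_ fA].
  have := ler_wpM2l (ltW d0) (_ : f (x - A) <= 2 * f x).
  by rewrite mulrCA mulrA; apply; lra.
have eE : e = 6 * d by rewrite /d; lra.
have := ler_wpM2r (ltW fx) mA; rewrite eE; move: ov tsq; rewrite ler_norml; lra.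
Unshelve. all: by end_near. Qed.

(** F^{2*}(x, x + t] - 2 F(x, x + t] = H_2(x) - H_2(x + t) is o(f(x)), since f is
    long-tailed, and f(x) is of the order of F(x, x + t]. *)
Lemma local_subexponential_of_excess2 t : 0 < t ->
  asym_eq (excess 2) (fun x => 2 * mu * f x) -> local_subexponential t F.
Proof.
move=> t0; have mu0 := mean_gt0; have mu20 : 0 < 2 * mu by lra.
move=> /asym_eqP-/(_ mu20 f_gt0)[lo hi]; split; first exact: Llt.
have near_close e : 0 < e -> \forall x \near +oo,
    `|incr (nconvol F 2) x (x + t) - 2 * incr F x (x + t)| <= e * incr F x (x + t).
  move=> e0; pose d := e * t / (4 * (2 * mu + 3)).
  have c0 : 0 < 4 * (2 * mu + 3) by lra.
  have d0 : 0 < d by apply: divr_gt0 => //; exact: mulr_gt0.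
  pose k := Num.min d 1; have k0 : 0 < k by rewrite lt_min d0 ltr01.
  have kd : k <= d by rewrite ge_min lexx.
  have k1 : k <= 1 by rewrite ge_min lexx orbT.
  have dE : d * (4 * (2 * mu + 3)) = e * t by rewrite mulfVK ?gt_eqF.
  have t20 : 0 < t / 2 by lra.
  near=> x; have fx : 0 < f x by near: x.
  have ft : 0 < f (x + t) by near: x; apply: (near_shift t f_gt0).
  have l0 : (2 * mu - k) * f x <= excess 2 x by near: x; exact: lo.
  have h0 : excess 2 x <= (2 * mu + k) * f x by near: x; exact: hi.
  have l1 : (2 * mu - k) * f (x + t) <= excess 2 (x + t).
    by near: x; apply: (near_shift t (lo _ k0)).
  have h1 : excess 2 (x + t) <= (2 * mu + k) * f (x + t).
    by near: x; apply: (near_shift t (hi _ k0)).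
  have fs : forall y, `|y| <= t -> `|f (x - y) - f x| <= k * f x.
    by near: x; exact: long_tailed_shift.
  have inc : forall u, `|u| <= t -> `|incr F x (x + u) - u * f x| <= t / 2 * f x.
    by near: x; exact: incr_uniform.
  have /inc : `|t| <= t by rewrite gtr0_norm.
  have /fs : `|- t| <= t by rewrite normrN gtr0_norm.
  rewrite opprK; have -> : incr (nconvol F 2) x (x + t) - 2 * incr F x (x + t) =
      excess 2 x - excess 2 (x + t).
    rewrite /excess (incr_tail (nconvol F 2)) (incr_tail F).
    move: (tail (nconvol F 2) x) (tail (nconvol F 2) (x + t)) => p q.
    move: (tail F x) (tail F (x + t)) => p' q'; ring.
  move=> fxt incF; rewrite ler_norml; move: fxt incF.
  move: l0 h0 l1 h1; move: (excess 2 x) (excess 2 (x + t)) (incr F x (x + t)).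
  move=> a b i l0 h0 l1 h1 fxt incF.
  have kg : k * (2 * mu + 3) * f x <= e * (t / 4) * f x.
    rewrite ler_wpM2r//; first exact: ltW.
    have := ler_wpM2r (_ : 0 <= 2 * mu + 3) kd; lra.
  have mg : `|2 * mu * (f (x + t) - f x)| <= 2 * mu * (k * f x).
    by rewrite normrM (gtr0_norm mu20) ler_wpM2l// ltW.
  have kft : k * f (x + t) <= k * (2 * f x).
    rewrite ler_wpM2l//; first exact: ltW.
    have := ler_wpM2r (ltW fx) k1; move: fxt; rewrite ler_norml; lra.
  have ei : e * (t / 2 * f x) <= e * i.
    by rewrite ler_wpM2l//; [exact: ltW|move: incF; rewrite ler_norml; lra].
  have ei0 : 0 <= e * (t * f x) by rewrite mulr_ge0 ?mulr_ge0// ltW.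
  by move: mg; rewrite ler_norml; lra.
apply/asym_eqP => //; first exact: incr_gt0_near.
split=> e e0; near=> x.
  have : `|incr (nconvol F 2) x (x + t) - 2 * incr F x (x + t)| <=
      e * incr F x (x + t) by near: x; exact: near_close.
  by rewrite ler_norml mulrBl; lra.
have : `|incr (nconvol F 2) x (x + t) - 2 * incr F x (x + t)| <=
    e * incr F x (x + t) by near: x; exact: near_close.
by rewrite ler_norml mulrDl; lra.
Unshelve. all: by end_near. Qed.


Lemma excess_ge n : asym_ge (excess 2) f (2 * mu) -> (2 <= n)%N ->
  asym_ge (excess n) f (n%:R * (n%:R - 1) * mu).
Proof.
move=> H2; elim: n => // -[//|[_ _|n IHn _]].
  by rewrite (_ : 2 * (2 - 1) * mu = 2 * mu); last by ring.
have mu0 := mean_gt0; have n1 : 0 < n.+2%:R - 1 :> R by rewrite subr_gt0 ltr1n.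
have -> : excess n.+3 = fun x => excess_smoothed n.+2 x + n.+2%:R * excess 2 x.
  by apply/funext => x; exact: excess_rec.
have -> : n.+3%:R * (n.+3%:R - 1) * mu =
    n.+2%:R * (n.+2%:R - 1) * mu + n.+2%:R * (2 * mu).
  by rewrite -[n.+3%:R]natr1; ring.
apply: asym_geD => //; apply: excess_smoothed_ge; last exact: IHn.
by rewrite !mulr_gt0.
Qed.

Lemma excess_le n : asym_le (fun x => incr (nconvol F 2) x (x + 1)) f 2 ->
  asym_le (excess 2) f (2 * mu) -> (2 <= n)%N ->
  asym_le (excess n) f (n%:R * (n%:R - 1) * mu).
Proof.
move=> S2 H2; elim: n => // -[//|[_ _|n IHn _]].
  by rewrite (_ : 2 * (2 - 1) * mu = 2 * mu); last by ring.
have mu0 := mean_gt0; have n1 : 0 < n.+2%:R - 1 :> R by rewrite subr_gt0 ltr1n.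
have -> : excess n.+3 = fun x => excess_smoothed n.+2 x + n.+2%:R * excess 2 x.
  by apply/funext => x; exact: excess_rec.
have -> : n.+3%:R * (n.+3%:R - 1) * mu =
    n.+2%:R * (n.+2%:R - 1) * mu + n.+2%:R * (2 * mu).
  by rewrite -[n.+3%:R]natr1; ring.
apply: asym_leD => //; apply: excess_smoothed_le => //; last exact: IHn.
by rewrite ltW// !mulr_gt0.
Qed.

(** The recursion read backwards: n H_2 is H_{n+1} minus a term with a known
    lower bound. *)
Lemma excess2_le n : asym_ge (excess 2) f (2 * mu) -> (2 <= n)%N ->
  asym_le (excess n) f (n%:R * (n%:R - 1) * mu) ->
  asym_le (excess 2) f (2 * mu).
Proof.
move=> H2; case: n => // -[//|[_|n _]].
  by rewrite (_ : 2 * (2 - 1) * mu = 2 * mu); last by ring.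
have mu0 := mean_gt0; have n1 : 0 < n.+2%:R - 1 :> R by rewrite subr_gt0 ltr1n.
have -> : excess n.+3 = fun x => excess_smoothed n.+2 x + n.+2%:R * excess 2 x.
  by apply/funext => x; exact: excess_rec.
have -> : n.+3%:R * (n.+3%:R - 1) * mu =
    n.+2%:R * (n.+2%:R - 1) * mu + n.+2%:R * (2 * mu).
  by rewrite -[n.+3%:R]natr1; ring.
move=> /asym_le_cancel; apply; first exact: ltr0Sn.
apply: excess_smoothed_ge; last exact: excess_ge.
by rewrite !mulr_gt0.
Qed.

End excess.

Unset Implicit Arguments.

Theorem proposition1 (R : realType) (F : law R) (F_nonneg : on_nonneg F) :
  (second_order_subexponential F ->
   forall n : nat, (2 <= n)%N ->
   asym_eq (fun x => tail (nconvol F n) x - n%:R * tail F x)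
           (fun x => n%:R * (n%:R - 1) * fine (mean F) * incr F x (x + 1)))
  /\
  ((forall t : R, 0 < t -> local_long_tailed t F) ->
   (mean F < +oo)%E ->
   asym_o (fun x => tail F x ^+ 2) (fun x => incr F x (x + 1)) ->
   (exists2 n : nat, (2 <= n)%N &
    asym_eq (fun x => tail (nconvol F n) x - n%:R * tail F x)
            (fun x => n%:R * (n%:R - 1) * fine (mean F) * incr F x (x + 1))) ->
   second_order_subexponential F).
Proof.
have coef_gt0 n : 0 < fine (mean F) -> (2 <= n)%N ->
    0 < n%:R * (n%:R - 1) * fine (mean F).
  move=> mu0 n2; rewrite !mulr_gt0 ?subr_gt0 ?ltr1n ?ltr0n//.
  exact: leq_trans n2.
split=> [[_ Foo Fsub F2] n n2|Llt Foo tail_sq [n n2 Fn]].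
  have Llt t (t0 : 0 < t) : local_long_tailed t F by have [] := Fsub t t0.
  have f_gt0 := incr_gt0_near Llt ltr01.
  have mu0 := mean_gt0 Llt F_nonneg Foo.
  have mu20 : 0 < 2 * fine (mean F) by rewrite mulr_gt0.
  have [lo hi] := (asym_eqP (excess F 2) mu20 f_gt0).1 F2.
  have [_ S2] := Fsub 1 ltr01.
  have [_ {}S2] := (asym_eqP _ (ltr0Sn R 1) f_gt0).1 S2.
  apply/(asym_eqP (excess F n) (coef_gt0 n mu0 n2) f_gt0); split.
    exact: excess_ge.
  exact: excess_le.
have f_gt0 := incr_gt0_near Llt ltr01.
have mu0 := mean_gt0 Llt F_nonneg Foo.
have mu20 : 0 < 2 * fine (mean F) by rewrite mulr_gt0.
have lo : asym_ge (excess F 2) (fun x => incr F x (x + 1)) (2 * fine (mean F)).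
  exact: excess2_ge.
have [_ hin] := (asym_eqP (excess F n) (coef_gt0 n mu0 n2) f_gt0).1 Fn.
have hi := excess2_le Llt F_nonneg Foo lo n2 hin.
have F2 := (asym_eqP (excess F 2) mu20 f_gt0).2 (conj lo hi).
split=> // t t0; exact: local_subexponential_of_excess2.
Qed.
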